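(* Let $G$ be a finite simple graph with at least one vertex, $K$ a field and $S=K[x_v : v\in V(G)]$. (a) The multiplicity $e(S/NI(G))$ equals the number of minimal dominating sets of $G$ of cardinality $\gamma(G)$. In particular $e(S/NI(G))\leq d(G)$, with equality if and only if $G$ is well-dominated. (b) If $V(G)$ is the disjoint union of maximal cliques $C_1,\ldots,C_r$ of $G$, each of which contains a free vertex, then $e(S/NI(G))=d(G)=\prod_{i=1}^r |C_i|$. In particular this holds when $G$ is a well-covered chordal graph or a whisker graph.
   Context: $N_G[v]$ is the closed neighborhood of $v$ and $NI(G)=\big(\prod_{w\in N_G[v]} x_w : v\in V(G)\big)$ is the closed neighborhood ideal. A dominating set is a set $D\subseteq V(G)$ with $D\cap N_G[v]\neq\emptyset$ for all $v$; minimal means no proper subset is dominating. $\gamma(G)$ is the minimum size of a dominating set; $d(G)$ is the number of minimal dominating sets of $G$. $G$ is well-dominated if all minimal dominating sets have the same size, and well-covered if all maximal independent sets have the same size. A clique is a set of pairwise adjacent vertices; a free vertex is a vertex lying in exactly one maximal clique. A whisker graph is a graph in which every vertex either has degree one or has a unique neighbor of degree one. $e(R)$ denotes the multiplicity of a standard graded ring $R$. $K$ is an infinite field. *)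

(* Defs.v *)
From HB Require Import structures.
From mathcomp Require Import all_boot all_order all_algebra.
From mathcomp Require Import mpoly.

Set Implicit Arguments.
Unset Strict Implicit.
Unset Printing Implicit Defensive.

Import GRing.Theory.

Section Graph.
Variables (n : nat) (adj : rel 'I_n).

Definition simple_graph : Prop := ssrbool.symmetric adj /\ irreflexive adj.

Definition closedN (v : 'I_n) : {set 'I_n} := [set w | (w == v) || adj v w].

Definition dominating (D : {set 'I_n}) : bool :=
  [forall v, [exists w in D, w \in closedN v]].

Definition minimal_dominating (D : {set 'I_n}) : bool :=
  dominating D && [forall D' : {set 'I_n}, (D' \proper D) ==> ~~ dominating D'].

(* gamma(G): minimum size of a dominating set (V(G) itself is dominating,
   of size n, so n is a correct initial value). *)
Definition gamma : nat := \big[minn/n]_(D : {set 'I_n} | dominating D) #|D|.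

Definition dnum : nat := #|[set D : {set 'I_n} | minimal_dominating D]|.

Definition nmin_gamma : nat :=
  #|[set D : {set 'I_n} | minimal_dominating D & #|D| == gamma]|.

Definition well_dominated : Prop :=
  forall D D', minimal_dominating D -> minimal_dominating D' -> #|D| = #|D'|.

Definition independent (I : {set 'I_n}) : bool :=
  [forall x in I, forall y in I, ~~ adj x y].

Definition well_covered : Prop :=
  forall I J, maxset independent I -> maxset independent J -> #|I| = #|J|.

Definition clique (C : {set 'I_n}) : bool :=
  [forall x in C, forall y in C, (x != y) ==> adj x y].

Definition maximal_clique (C : {set 'I_n}) : bool := maxset clique C.

Definition free_vertex (v : 'I_n) : bool :=
  #|[set C : {set 'I_n} | maximal_clique C & v \in C]| == 1.

Definition chordal : Prop :=
  forall s : seq 'I_n, uniq s -> 3 < size s -> cycle adj s ->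
    exists i j, [/\ i < j, j < size s, j != i.+1,
                   ~~ ((i == 0) && (j == (size s).-1)) &
                   forall x0, adj (nth x0 s i) (nth x0 s j)]%N.

Definition degree (v : 'I_n) : nat := #|[set w | adj v w]|.

Definition whisker_graph : Prop :=
  forall v, (degree v == 1%N) || (#|[set w | adj v w & degree w == 1%N]| == 1%N).

Definition free_clique_partition (P : {set {set 'I_n}}) : Prop :=
  partition P [set: 'I_n] /\
  forall C, C \in P -> maximal_clique C /\ exists2 v, v \in C & free_vertex v.

End Graph.

Section Hilbert.
Variables (K : fieldType) (n : nat) (adj : rel 'I_n).
Local Open Scope ring_scope.
Local Open Scope mpoly_scope.

Definition NIgen (v : 'I_n) : {mpoly K[n]} := \prod_(w in closedN adj v) 'X_w.

(* coordinates of the degree-k homogeneous component of p in the monomial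
   basis of S_k (indexed by monomials of degree <= k; coordinates at
   monomials of degree < k are 0) *)
Definition hcomp (k : nat) (p : {mpoly K[n]}) : {ffun 'X_{1..n < k.+1} -> K^o} :=
  [ffun m : 'X_{1..n < k.+1} => if mdeg (bmnm m) == k then p@_(bmnm m) else 0].

Definition Sk (k : nat) : {vspace {ffun 'X_{1..n < k.+1} -> K^o}} :=
  <<[seq hcomp k 'X_[bmnm m] | m <- enum [set: 'X_{1..n < k.+1}] & mdeg (bmnm m) == k]>>%VS.

Definition NIk (k : nat) : {vspace {ffun 'X_{1..n < k.+1} -> K^o}} :=
  <<[seq hcomp k ('X_[bmnm mv.1] * NIgen mv.2)
    | mv <- enum [set: ('X_{1..n < k.+1} * 'I_n)%type]
    & (mdeg (bmnm mv.1) + #|closedN adj mv.2| == k)%N]>>%VS.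

Definition hilbNI (k : nat) : nat := (\dim (Sk k) - \dim (NIk k))%N.

End Hilbert.

Local Open Scope ring_scope.

(* Multiplicity of a standard graded K-algebra R with Hilbert function H
   (Hilbert-Samuel form): e is the multiplicity iff, with d = dim R, the
   function k |-> sum_{j<=k} H(j) agrees for k >> 0 with a polynomial of
   degree d whose leading coefficient is e/d!. *)
Definition is_multiplicity (H : nat -> nat) (e : nat) : Prop :=
  exists (d : nat) (P : {poly rat}),
    [/\ size P = d.+1,
        lead_coef P = (e%:R / (d`!)%:R)%R &
        exists k0, forall k, (k0 <= k)%N ->
          P.[k%:R] = ((\sum_(j < k.+1) H j)%N)%:R].

(* Main.v *)
Require Import Defs.
From HB Require Import structures.
From mathcomp Require Import all_boot all_order all_algebra.
From mathcomp Require Import mpoly zify.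

(* A monomial lies outside NI(G) iff the set of variables missing from it is
   dominating. The monomials of degree at most k that miss exactly the variables
   in D number C(k, n - |D|), so the cumulative Hilbert function of S/NI(G) is
   the sum of C(k, n - |D|) over the dominating sets D, and its leading
   coefficient counts the dominating sets of size gamma(G).

   For a partition into maximal cliques with free vertices, a set is dominating
   iff it meets every block, so the minimal dominating sets are the transversals.
   In a whisker graph the blocks are the closed neighbourhoods of the leaves. In
   a chordal graph, deleting closed neighbourhoods of simplicial vertices one
   after the other gives a maximal independent set I and a partition of the
   vertices into |I| cliques. If no vertex of a block C had its closed
   neighbourhood inside C, some independent set T disjoint from C would dominate
   C; a maximal independent set containing T would then avoid C, hence have fewer
   than |I| elements, contradicting well-coveredness. *)

Set Implicit Arguments.
Unset Strict Implicit.
Unset Printing Implicit Defensive.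

(** * Dominating sets *)

Section Domination.
Variables (n : nat) (adj : rel 'I_n).
Implicit Types (D : {set 'I_n}) (v w : 'I_n).

Lemma closedN_id v : v \in closedN adj v.
Proof. by rewrite inE eqxx. Qed.

Lemma dominatingP D :
  reflect (forall v, exists2 w, w \in D & w \in closedN adj v)
          (dominating adj D).
Proof.
apply: (iffP forallP) => domD v; first by have /exists_inP := domD v.
exact/exists_inP.
Qed.

Lemma dominating_setT : dominating adj setT.
Proof. by apply/dominatingP => v; exists v; rewrite ?closedN_id. Qed.

Lemma minimal_dominatingE D :
  minimal_dominating adj D = minset (dominating adj) D.
Proof.
apply/andP/minsetP => [[domD /forallP minD]|[domD minD]]; split=> //.
  move=> D' domD' sD'D; apply/eqP; rewrite eqEproper sD'D /=.
  by apply: contraL domD' => /(implyP (minD D')).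
apply/forallP => D'; apply/implyP => /properP[sD'D [x xD]].
by apply: contra => domD'; rewrite (minD D').
Qed.

Lemma gamma_le D : dominating adj D -> gamma adj <= #|D|.
Proof.
move=> domD; rewrite /gamma; have := mem_index_enum D.
elim: (index_enum _) => // D' s IHs; rewrite inE big_cons.
case/predU1P=> [<-|/IHs leD]; first by rewrite domD geq_minl.
by case: ifP => // _; rewrite geq_min leD orbT.
Qed.

Lemma gamma_attained : exists2 D, dominating adj D & #|D| = gamma adj.
Proof.
rewrite /gamma; elim/big_ind: _ => [|x y [D domD <-] [D' domD' <-]|D domD].
- by exists setT; rewrite ?dominating_setT // cardsT card_ord.
- by rewrite /minn; case: ifP => _; [exists D | exists D'].
- by exists D.
Qed.

(** A proper dominating subset would have fewer than [gamma] elements, so minimality is automatic at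
    this size. *)
Lemma minimum_dominating D :
  minimal_dominating adj D && (#|D| == gamma adj)
  = dominating adj D && (#|D| == gamma adj).
Proof.
apply: andb_id2r => /eqP cardD; rewrite minimal_dominatingE.
apply/minsetP/idP => [[]//|domD]; split=> // D' domD' sD'D; apply/eqP.
by rewrite eqEcard sD'D cardD gamma_le.
Qed.

Lemma nmin_gammaE :
  nmin_gamma adj = #|[set D | dominating adj D & #|D| == gamma adj]|.
Proof. by apply: eq_card => D; rewrite !inE minimum_dominating. Qed.

Lemma minimum_dominating_exists :
  exists2 D, minimal_dominating adj D & #|D| = gamma adj.
Proof.
have [D domD cardD] := gamma_attained; exists D => //.
by have := minimum_dominating D; rewrite domD cardD eqxx !andbT.
Qed.

Lemma nmin_gamma_gt0 : 0 < nmin_gamma adj.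
Proof.
have [D minD /eqP cardD] := minimum_dominating_exists.
by apply/card_gt0P; exists D; rewrite inE minD.
Qed.

Lemma nmin_gamma_sub :
  [set D | minimal_dominating adj D & #|D| == gamma adj]
    \subset [set D | minimal_dominating adj D].
Proof. by apply/subsetP => D; rewrite !inE => /andP[]. Qed.

Lemma nmin_gamma_le_dnum : nmin_gamma adj <= dnum adj.
Proof. exact: subset_leq_card nmin_gamma_sub. Qed.

Lemma nmin_gamma_eq_dnum : nmin_gamma adj = dnum adj <-> well_dominated adj.
Proof.
split=> [eq_nd D D' minD minD' | wd].
  have /setP eqS : [set D | minimal_dominating adj D & #|D| == gamma adj]
      = [set D | minimal_dominating adj D].
    by apply/eqP; rewrite eqEcard nmin_gamma_sub -/(dnum adj) -eq_nd leqnn.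
  by move: (eqS D) (eqS D'); rewrite !inE minD minD' => /eqP-> /eqP->.
have [D0 minD0 cardD0] := minimum_dominating_exists.
apply: eq_card => D; rewrite !inE; case minD: (minimal_dominating adj D) => //=.
by rewrite -cardD0 (wd D D0) ?eqxx.
Qed.

End Domination.

(** * Partitions into maximal cliques with free vertices *)

Section CliquePartition.
Variables (n : nat) (adj : rel 'I_n).
Hypothesis Gsimple : simple_graph adj.
Let adj_sym : ssrbool.symmetric adj := Gsimple.1.
Implicit Types (D C : {set 'I_n}) (u v w : 'I_n) (P : {set {set 'I_n}}).

Lemma cliqueP C :
  reflect (forall x y, x \in C -> y \in C -> x != y -> adj x y) (clique adj C).
Proof.
apply: (iffP forall_inP) => [clC x y xC yC|clC x xC].
  by move/forall_inP: (clC x xC) => /(_ y yC)/implyP.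
by apply/forall_inP => y yC; apply/implyP; apply: clC.
Qed.

Lemma clique_sub_closedN C v : clique adj C -> v \in C -> C \subset closedN adj v.
Proof.
move=> /cliqueP clC vC; apply/subsetP => w wC; rewrite inE.
by have [//|neq_wv] := eqVneq w v; apply: clC; rewrite // eq_sym.
Qed.

(** Every clique through v lies in N[v], hence in C, so no other maximal clique passes through v. *)
Lemma closedN_clique_free C v :
  clique adj C -> v \in C -> closedN adj v \subset C ->
  maximal_clique adj C /\ free_vertex adj v.
Proof.
move=> clC vC sNC; have maxC : maximal_clique adj C.
  apply/maxsetP; split=> // B clB sCB; apply/eqP; rewrite eqEsubset sCB andbT.
  by apply: subset_trans sNC; apply: clique_sub_closedN; rewrite ?(subsetP sCB).
split=> //; apply/cards1P; exists C; apply/setP => B; rewrite !inE.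
apply/andP/eqP => [[maxB vB]|-> //]; apply/esym.
have [clB maxBP] := maxsetP maxB; apply: maxBP => //.
exact: subset_trans (clique_sub_closedN clB vB) sNC.
Qed.

(** Any edge at v extends to a maximal clique through v, which must be C because v is free. *)
Lemma free_closedN C v :
  maximal_clique adj C -> v \in C -> free_vertex adj v -> closedN adj v = C.
Proof.
move=> maxC vC /cards1P[B eqB]; have clC := maxsetp maxC.
apply/eqP; rewrite eqEsubset clique_sub_closedN // andbT.
apply/subsetP => w wv; have [C' maxC' sC'] :
  {C' | maxset (clique adj) C' & [set v; w] \subset C'}.
  apply/maxset_exists/cliqueP => x y; move: wv; rewrite !inE.
  case/predU1P => [->|avw]; rewrite ?orbb; first by move=> /eqP-> /eqP->; rewrite eqxx.
  by case/pred2P=> ->; case/pred2P=> ->; rewrite ?eqxx // adj_sym.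
have [vC' wC'] : v \in C' /\ w \in C' by split; apply: (subsetP sC'); rewrite !inE eqxx ?orbT.
have : C' \in [set C | maximal_clique adj C & v \in C] by rewrite inE vC' andbT.
have : C \in [set C | maximal_clique adj C & v \in C] by rewrite inE maxC.
by rewrite eqB !inE => /eqP-> /eqP <-.
Qed.

Lemma free_clique_partition_intro P :
    partition P [set: 'I_n] ->
    (forall C, C \in P ->
      clique adj C /\ exists2 v, v \in C & closedN adj v \subset C) ->
  free_clique_partition adj P.
Proof.
move=> partP cliqP; split=> // C /cliqP[clC [v vC sNC]].
by have [maxC freev] := closedN_clique_free clC vC sNC; split=> //; exists v.
Qed.

Variable P : {set {set 'I_n}}.
Hypothesis freeP : free_clique_partition adj P.
Let partP : partition P [set: 'I_n] := freeP.1.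

(** A block is N[v] for its free vertex v, so dominating v means meeting the block. Conversely, the
    block of any v is a clique, hence contained in N[v]. *)
Lemma dominating_partition D :
  dominating adj D = [forall C in P, D :&: C != set0].
Proof.
apply/dominatingP/forall_inP => [domD C CP|meetD v].
  have [maxC [v vC freev]] := freeP.2 C CP; have [w wD] := domD v.
  rewrite (free_closedN maxC vC freev) => wC.
  by apply/set0Pn; exists w; rewrite inE wD.
have vP : v \in cover P by rewrite (cover_partition partP) inE.
have /meetD/set0Pn[w] : pblock P v \in P by rewrite pblock_mem.
rewrite inE => /andP[wD wP]; exists w => //.
have [maxC _] := freeP.2 _ (pblock_mem vP); have clC := maxsetp maxC.
by apply: (subsetP (clique_sub_closedN clC _)); rewrite ?mem_pblock.
Qed.

Lemma minimal_dominating_partition D :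
  minimal_dominating adj D = is_transversal D P [set: 'I_n].
Proof.
rewrite minimal_dominatingE /is_transversal partP subsetT /=.
have trivP := partition_trivIset partP.
apply/minsetP/forall_inP => [[domD minD] C CP | trD].
  have := domD; rewrite dominating_partition => /forall_inP meetD.
  have /set0Pn[x xDC] := meetD C CP; have /setIP[xD xC] := xDC.
  apply/cards1P; exists x; apply/setP => y; rewrite in_set1.
  apply/idP/eqP => [/setIP[yD yC]|-> //].
  apply/eqP; apply: contraLR yD => neq_yx.
  (* If x and y are distinct elements of D in C, then D without y still meets every block: C through
     x, the others as before. *)
  have <- : D :\ y = D; last by rewrite !inE eqxx.
  apply: minD; last exact: subD1set.
  rewrite dominating_partition; apply/forall_inP => B BP.
  have [z /setIP[zD zB]] := set0Pn _ (meetD B BP).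
  have [eq_zy|neq_zy] := eqVneq z y; last first.
    by apply/set0Pn; exists z; rewrite !inE neq_zy zD.
  have -> : B = C.
    by rewrite -(def_pblock trivP BP zB) eq_zy (def_pblock trivP CP yC).
  by apply/set0Pn; exists x; rewrite !inE eq_sym neq_yx xD.
split=> [|D' domD' sD'D].
  rewrite dominating_partition; apply/forall_inP => C CP.
  by rewrite -card_gt0 (eqP (trD C CP)).
(* D' meets the block of x, and x is the only element of D there, so x lies in D'. *)
apply/eqP; rewrite eqEsubset sD'D /=; apply/subsetP => x xD.
have xP : x \in cover P by rewrite (cover_partition partP) inE.
move: domD'; rewrite dominating_partition => /forall_inP/(_ _ (pblock_mem xP)).
case/set0Pn => y /setIP[yD' yx]; have /cards1P[z /setP eqz] := trD _ (pblock_mem xP).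
move: (eqz x) (eqz y); rewrite !inE xD (subsetP sD'D y) // yx mem_pblock xP.
by move=> /esym/eqP-> /esym/eqP<-.
Qed.

Lemma free_clique_partition_well_dominated : well_dominated adj.
Proof.
move=> D D'; rewrite !minimal_dominating_partition.
by move=> /card_transversal-> /card_transversal->.
Qed.

End CliquePartition.

(** Transversals correspond to the functions choosing an element of each block, and these form a
    [pfamily] of known size. *)
Lemma card_transversals (T : finType) (P : {set {set T}}) (D : {set T}) :
  partition P D -> #|[set X | is_transversal X P D]| = \prod_(C in P) #|C|.
Proof.
move=> partP; have trivP := partition_trivIset partP.
(* Choice functions need a default value x0 outside P. For empty D there is none, but then P is
   empty and [set0] is the only transversal. *)
have [D0 | [x0 _]] := set_0Vmem D.
  move: partP; rewrite D0 partition_set0 => /eqP->; rewrite big_set0.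
  apply/eqP/cards1P; exists set0; apply/setP => X; rewrite !inE /is_transversal.
  rewrite partition_set0 eqxx subset0 /=; case: eqP => //= _.
  by apply/forall_inP => B; rewrite inE.
pose F := pfamily x0 (mem P) (fun C : {set T} => mem C).
pose g (f : {ffun {set T} -> T}) := [set f C | C in P].
have FP f : f \in F -> forall C, C \in P -> f C \in C.
  by case/pfamilyP.
have gI f C : f \in F -> C \in P -> g f :&: C = [set f C].
  move=> fF CP; apply/setP => x; rewrite !inE; apply/andP/eqP.
    case=> /imsetP[B BP ->] fBC; congr (f _).
    by rewrite -(def_pblock trivP BP (FP f fF B BP)) (def_pblock trivP CP fBC).
  by move=> ->; split; [apply: imset_f | apply: FP].
have -> : [set X | is_transversal X P D] = g @: F.
  apply/setP => X; rewrite inE; apply/idP/imsetP => [trX | [f fF ->]].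
    pose f := [ffun C => if C \in P then odflt x0 [pick x in X :&: C] else x0].
    have fX C : C \in P -> X :&: C = [set f C].
      move=> CP; rewrite ffunE CP; have [_ _ /forall_inP/(_ C CP)] := and3P trX.
      case/cards1P => y ->; case: pickP => [z|/(_ y)]; last by rewrite !inE eqxx.
      by rewrite inE => /eqP->.
    have fXC C : C \in P -> (f C \in X) && (f C \in C).
      by move=> CP; rewrite -in_setI fX ?set11.
    exists f.
      apply/pfamilyP; split=> [|C CP]; last by case/andP: (fXC C CP).
      by apply/supportP => C; rewrite ffunE => /negbTE->.
    apply/setP => x; apply/idP/imsetP => [xX | [C CP ->]]; last first.
      by case/andP: (fXC C CP).
    have [_ /subsetP/(_ x xX) xD _] := and3P trX.
    rewrite -(cover_partition partP) in xD.
    exists (pblock P x); first exact: pblock_mem.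
    by apply/eqP; rewrite -in_set1 -fX ?pblock_mem // inE xX mem_pblock.
  rewrite /is_transversal partP /=; apply/andP; split.
    apply/subsetP => _ /imsetP[C CP ->]; rewrite -(cover_partition partP).
    by apply/bigcupP; exists C => //; apply: FP.
  by apply/forall_inP => C CP; rewrite gI // cards1.
rewrite card_in_imset => [|f f' fF f'F eq_g].
  by rewrite card_pfamily foldrE big_image.
(* On P the image determines f through its intersections with the blocks; off P every member of F
   takes the value x0. *)
apply/ffunP => C; have [CP|CP] := boolP (C \in P).
  by apply/set1P; rewrite -gI // -eq_g gI ?set11.
case/pfamilyP: fF => /supportP-> // _.
by case/pfamilyP: f'F => /supportP-> // _.
Qed.

(** * Chordal and whisker graphs *)

Section Chordal.
Variables (n : nat) (adj : rel 'I_n).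
Hypothesis Gsimple : simple_graph adj.
Let adj_sym : ssrbool.symmetric adj := Gsimple.1.
Let adj_irr : irreflexive adj := Gsimple.2.
Implicit Types (A C K Q S U : {set 'I_n}) (u v w x y z : 'I_n).
Implicit Types (t : seq 'I_n) (P : {set {set 'I_n}}).

Definition induced A : rel 'I_n := [rel x y | [&& x \in A, y \in A & adj x y]].

Definition component A x : {set 'I_n} := [set y | connect (induced A) x y].

Lemma induced_connect_sym A : connect_sym (induced A).
Proof. by apply: sym_connect_sym => x y; rewrite /induced /= adj_sym andbCA. Qed.

Lemma component_id A x : x \in component A x.
Proof. by rewrite inE connect0. Qed.

Lemma component_sub A x : x \in A -> component A x \subset A.
Proof.
move=> xA; apply/subsetP => y; rewrite inE => /connectP[p].
elim: p x xA => [|z p IHp] x xA /=; first by move=> _ ->.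
by case/andP=> /and3P[_ zA _]; apply: IHp.
Qed.

Lemma component_adj A x y z :
  y \in component A x -> y \in A -> z \in A -> adj y z -> z \in component A x.
Proof.
rewrite !inE => xy yA zA yz; apply: connect_trans xy (connect1 _).
by rewrite /induced /= yA zA.
Qed.

Lemma component_path A x y z :
    y \in component A x -> z \in component A x ->
  exists p, [/\ path adj y p, last y p = z & {subset y :: p <= component A x}].
Proof.
move=> yx zx; have /connectP[p yp ->] : connect (induced A) y z.
  move: yx zx; rewrite !inE => xy xz; apply: connect_trans xz.
  by rewrite induced_connect_sym.
exists p; split=> //; first by apply: sub_path yp => u v /and3P[].
move=> w wp; move: yx; rewrite !inE => /connect_trans-> //.
exact: path_connect yp _ wp.
Qed.

Hypothesis adj_chordal : chordal adj.

(* Otherwise a shortest such walk, closed up through k and k', would be a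
   chordless cycle of length at least 4. *)
Lemma chordal_common_neighbor k k' t :
    adj k k' -> 0 < size t -> sorted adj t -> k \notin t -> k' \notin t ->
    adj k' (nth k t 0) -> adj k (nth k t (size t).-1) ->
  exists2 z, z \in t & adj k z && adj k' z.
Proof.
move=> kk'; have [m] := ubnP (size t); elim: m t => // m IHm [//|x0 p0].
set t0 := x0 :: p0 => size_t0 _ path_t0 kt0 k't0 /= k't0_0 kt0_l.
(* Cutting out loops keeps both ends of the walk; [chordal] speaks only of cycles without
   repetition. *)
have {size_t0 path_t0 k't0_0 kt0_l} [t [[Ut t_gt0 sz_t] [sorted_t k't_0 kt_l] st]] :
    exists t, [/\ [/\ uniq t, 0 < size t & size t < m.+1],
      [/\ sorted adj t, adj k' (nth k t 0) & adj k (nth k t (size t).-1)]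
      & {subset t <= t0}].
  move: kt0_l; rewrite nth_last /=.
  case/shortenP: path_t0 => p path_p Up sp kp; exists (x0 :: p); split; last first.
  - by move=> z; rewrite !inE => /predU1P[->|/sp->]; rewrite ?eqxx ?orbT.
  - by split=> //; rewrite nth_last.
  split=> //; apply: leq_ltn_trans size_t0; rewrite ltnS uniq_leq_size //.
  by case/andP: Up.
suff /exists_inP[z zt kz] : [exists z in t, adj k z && adj k' z].
  by exists z => //; apply: st.
apply: contraT; rewrite negb_exists_in => /forall_inP no_z; suff: False by [].
have {}kt0 : k \notin t by apply: contra kt0 => /st.
have {}k't0 : k' \notin t by apply: contra k't0 => /st.
(* By induction such a walk would contain a common neighbour of k and k', which would also lie in
   t. *)
have shorter t' : 0 < size t' -> size t' < size t -> sorted adj t' ->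
    {subset t' <= t} -> adj k' (nth k t' 0) ->
    adj k (nth k t' (size t').-1) -> False.
  move=> t'_gt0 sz_t' sorted_t' st't k't' kt'.
  have [|||||z /st't zt kz] := IHm t' _ t'_gt0 sorted_t' => //.
  - exact: leq_trans sz_t' _.
  - by apply: contra kt0 => /st't.
  - by apply: contra k't0 => /st't.
  by move: (no_z z zt); rewrite kz.
have no_k' i : 0 < i < size t -> ~~ adj k' (nth k t i).
  case/andP=> i_gt0 lt_it; apply/negP => k't_i.
  apply: (shorter (drop i t)); rewrite ?size_drop ?nth_drop ?addn0 //; try lia.
  - exact: drop_sorted.
  - exact: mem_drop.
  by have -> : i + (size t - i).-1 = (size t).-1 by lia.
have no_k i : i.+1 < size t -> ~~ adj k (nth k t i).
  move=> lt_it; have sz : size (take i.+1 t) = i.+1 by rewrite size_takel // ltnW.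
  apply/negP => kt_i; apply: (shorter (take i.+1 t)); rewrite ?sz ?nth_take //.
  - exact: take_sorted.
  - exact: mem_take.
(* A chord of t would allow the vertices between its ends to be skipped. *)
have no_chord i j : i.+1 < j < size t -> ~~ adj (nth k t i) (nth k t j).
  case/andP=> lt_ij lt_jt; apply/negP => tij; pose t' := take i.+1 t ++ drop j t.
  have sz1 : size (take i.+1 t) = i.+1 by rewrite size_takel //; lia.
  have sz : size t' = i.+1 + (size t - j) by rewrite size_cat sz1 size_drop.
  apply: (shorter t'); rewrite ?sz //; try lia.
  - apply/(sortedP k) => l; rewrite sz => lt_l; rewrite !nth_cat sz1 !nth_drop.
    have adj_t a : a.+1 < size t -> adj (nth k t a) (nth k t a.+1).
      exact: (sortedP k sorted_t).
    case: (ltngtP l i) => [lt_li|lt_il|->].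
    + rewrite !ltnS (ltnW lt_li) lt_li !nth_take //; try lia.
      by apply: adj_t; lia.
    + have -> : (l < i.+1) = false by lia.
      have -> : (l.+1 < i.+1) = false by lia.
      have -> : j + (l.+1 - i.+1) = (j + (l - i.+1)).+1 by lia.
      by apply: adj_t; lia.
    + by rewrite ltnSn ltnn nth_take // subnn addn0.
  - by move=> z; rewrite mem_cat => /orP[/mem_take|/mem_drop].
  - by rewrite nth_cat sz1 /= nth_take.
  rewrite nth_cat sz1 nth_drop; have -> : ((i.+1 + (size t - j)).-1 < i.+1) = false by lia.
  by have -> : j + ((i.+1 + (size t - j)).-1 - i.+1) = (size t).-1 by lia.
(* A single vertex would be adjacent to both k and k'. Hence the cycle below has at least 4
   vertices. *)
have sz_gt1 : 1 < size t.
  rewrite ltn_neqAle t_gt0 andbT; apply/eqP => sz1.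
  by have := no_z _ (mem_nth k t_gt0); rewrite k't_0 -[0]/(1.-1) {1}sz1 kt_l.
have [|||i [j [lt_ij lt_jt neq_ji neq_0l /(_ k)]]] := adj_chordal (s := k' :: rcons t k).
- rewrite /= mem_rcons inE negb_or k't0 andbT rcons_uniq kt0 Ut.
  by rewrite !andbT eq_sym; apply: contraTneq kk' => ->; rewrite adj_irr.
- by rewrite /= size_rcons.
- move: kt_l; rewrite nth_last; case: (t) t_gt0 sorted_t k't_0 => //= x p _ xp k'x kl.
  by rewrite k'x !rcons_path xp last_rcons kk' adj_sym kl.
rewrite /= size_rcons in lt_jt neq_0l.
(* In the cycle, position 0 is k', the entries of t are shifted by one, and the last position is k.
   The chord is excluded by [no_k'], [no_chord] or [no_k]. *)
case: j lt_ij lt_jt neq_ji neq_0l => // j; case: i => [|i] /= lt_ij lt_jt neq_ji neq_0l.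
  rewrite nth_rcons; have -> : j < size t by lia.
  by apply/negP/no_k'; lia.
rewrite !nth_rcons; have -> : i < size t by lia.
case: ltngtP => [lt_j|lt_j|eq_j]; [|lia|].
  by apply/negP/no_chord; lia.
by rewrite adj_sym; apply/negP/no_k; lia.
Qed.

(* Some q adjacent to as many elements of S as possible works: if k in S were
   missed, the first neighbour of k on a walk from q inside Q would, by
   chordal_common_neighbor, be adjacent to k and to all neighbours of q in S. *)
Lemma chordal_component_dominates A S a :
    a \in A -> clique adj S -> [disjoint S & A] ->
    (forall k, k \in S -> exists2 y, y \in component A a & adj k y) ->
  exists2 q, q \in component A a & forall k, k \in S -> adj k q.
Proof.
move=> aA /cliqueP clS disSA nbS; pose nb q := [set k in S | adj k q].
have [q qa max_q] := arg_maxnP (fun q => #|nb q|) (component_id A a).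
exists q => // k kS; apply: contraT => not_kq.
have [y ya ky] := nbS k kS; have [p [path_p last_p sub_p]] := component_path qa ya.
have has_k : has (adj k) (q :: p).
  by apply/hasP; exists y => //; rewrite -last_p mem_last.
(* t runs from q to the first neighbour of k on the walk. *)
pose i := find (adj k) (q :: p); pose t := take i.+1 (q :: p).
have lt_i : i < size (q :: p) by rewrite -has_find.
have sz : size t = i.+1 by rewrite size_takel.
have sub_t z : z \in t -> z \in component A a by move/mem_take/sub_p.
have notS_t z : z \in S -> z \notin t.
  move=> zS; apply: contraL (zS) => /sub_t/(subsetP (component_sub aA)).
  by apply: contraL => zS'; rewrite (disjointFr disSA).
have kt_i : adj k (nth k t i) by rewrite nth_take // nth_find.
have first_k z : z \in t -> adj k z -> z = nth k t i.
  move=> zt kz; rewrite -(nth_index k zt); congr nth.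
  have lt_z : index z t < i.+1 by rewrite -sz index_mem.
  apply/eqP; rewrite eqn_leq -ltnS lt_z /= leqNgt; apply/negP => lt_zi.
  have := before_find k lt_zi; rewrite -(nth_take _ lt_z) -/t nth_index //.
  by rewrite kz.
(* The last vertex of t is adjacent to k and to all of [nb q], against the choice of q: the common
   neighbour found on t must be that vertex, as no other one on t is adjacent to k. *)
have /subset_leq_card : k |: nb q \subset nb (nth k t i).
  apply/subsetP => k'; rewrite !inE => /predU1P[->|/andP[k'S k'q]]; first by rewrite kS.
  rewrite k'S /=; have kk' : adj k k'.
    by apply: clS => //; apply: contraNneq not_kq => ->.
  have [||||z zt /andP[kz k'z]] := chordal_common_neighbor kk' _ _ (notS_t k kS) (notS_t k' k'S).
  - by rewrite sz.
  - exact: take_sorted.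
  - by rewrite nth_take.
  - by rewrite sz.
  by rewrite -(first_k z zt kz).
rewrite cardsU1 inE kS (negbTE not_kq) add1n; apply: contraLR => _.
by rewrite -leqNgt; apply/max_q/sub_t; rewrite mem_nth ?sz.
Qed.

(** Induction on the size of U minus K. Let Q be the component of x there, S the vertices of K with
    a neighbour in Q, and q in Q adjacent to all of S. If Q is just q, then q works. Otherwise
    recurse on Q and S together with the clique [q |: S]: the vertex found lies in Q and has all its
    neighbours in U inside the union of Q and S. *)
Lemma chordal_simplicial U K x :
    clique adj K -> K \subset U -> x \in U :\: K ->
  exists2 v, v \in U :\: K & clique adj (closedN adj v :&: U).
Proof.
have [m] := ubnP #|U :\: K|; elim: m U K x => // m IHm U K x.
rewrite ltnS => leUK clK sKU xUK; set A := U :\: K in xUK leUK.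
pose Q := component A x; have sQA : Q \subset A := component_sub xUK.
pose S := [set k in K | [exists y in Q, adj k y]].
have sSK : S \subset K by apply/subsetP => k; rewrite inE => /andP[].
have clS : clique adj S.
  by apply/cliqueP => y z /(subsetP sSK) yK /(subsetP sSK) zK; apply: (cliqueP _ _ clK).
have [||q qQ Sq] := chordal_component_dominates xUK clS.
- rewrite disjoint_sym; apply/pred0P => y /=; rewrite !inE.
  by case: (y \in K); rewrite ?andbF.
- by move=> k; rewrite inE => /andP[_ /exists_inP].
have clSq : clique adj (q |: S).
  apply/cliqueP => y z; rewrite !in_setU1 => /predU1P[->|yS] /predU1P[->|zS].
  - by rewrite eqxx.
  - by rewrite adj_sym Sq.
  - by rewrite Sq.
  exact: (cliqueP _ _ clS).
have QA y : y \in Q -> y \in A by move/(subsetP sQA).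
have nbQ v : v \in Q -> closedN adj v :&: U \subset Q :|: S.
  move=> vQ; apply/subsetP => y /setIP[]; rewrite !inE.
  case/predU1P=> [-> _|vy yU]; first by move: vQ; rewrite inE => ->.
  have [yK|yK] := boolP (y \in K); last first.
    apply/orP; left; have := component_adj vQ (QA v vQ) (z := y).
    by rewrite !inE yK yU; apply.
  by apply/orP; right; apply/exists_inP; exists v; rewrite // adj_sym.
have [sub_q|] := boolP (Q \subset [set q]).
  exists q; first exact: QA.
  apply/cliqueP => y z yN zN; apply: (cliqueP _ _ clSq).
    by have := subsetP (nbQ q qQ) y yN; rewrite !in_setU => /orP[/(subsetP sub_q)|] ->;
      rewrite ?orbT.
  by have := subsetP (nbQ q qQ) z zN; rewrite !in_setU => /orP[/(subsetP sub_q)|] ->;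
    rewrite ?orbT.
case/subsetPn => y yQ; rewrite inE => neq_yq.
have notS z : z \in Q -> z \notin S.
  move/QA; rewrite inE => /andP[zK _]; apply: contra zK; exact: (subsetP sSK).
have UK : (Q :|: S) :\: (q |: S) = Q :\ q.
  apply/setP => z; rewrite !in_setD !in_setU !in_set1 negb_or.
  by have := notS z; case: (z \in Q) => [/(_ isT) -> | _]; case: (z \in S); rewrite ?andbT ?andbF.
(* What remains outside the clique is Q without q, so the measure drops; y shows that it is
   nonempty. *)
have [|||v] := IHm (Q :|: S) (q |: S) y _ clSq.
- rewrite UK; apply: leq_trans leUK; apply: proper_card; apply/properP.
  by split; [apply: subset_trans sQA; apply: subD1set | exists q; rewrite ?QA // !inE eqxx].
- by apply: setSU; rewrite sub1set.
- by rewrite UK !inE neq_yq; move: yQ; rewrite inE.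
rewrite UK in_setD1 => /andP[_ vQ] clN; exists v; first exact: QA.
have sN : closedN adj v :&: U \subset closedN adj v :&: (Q :|: S).
  by rewrite subsetI subsetIl nbQ.
apply/cliqueP => z w /(subsetP sN) zN /(subsetP sN) wN; exact: (cliqueP _ _ clN).
Qed.

(** A simplicial vertex v of the subgraph on U, obtained from the empty clique, contributes the
    block of its closed neighbourhood in U and joins I; no vertex left for the induction is adjacent
    to v. *)
Lemma chordal_clique_cover U :
  exists P (I : {set 'I_n}), [/\ partition P U, {in P, forall C, clique adj C}, I \subset U,
    independent adj I & (forall u, u \in U -> exists2 w, w \in I & u \in closedN adj w)
      /\ #|I| = #|P|].
Proof.
have [m] := ubnP #|U|; elim: m U => // m IHm U leU.
have [-> | [x xU]] := set_0Vmem U.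
  exists set0, set0; split; rewrite ?sub0set ?partition_set0 //.
  - by move=> C; rewrite inE.
  - by apply/forall_inP => y; rewrite inE.
  by split=> [u|]; rewrite ?inE ?cards0.
have [|||v] := @chordal_simplicial U set0 x; rewrite ?sub0set ?setD0 //.
  by apply/cliqueP => y z; rewrite inE.
move=> vU clC; set C := _ :&: U in clC.
have vC : v \in C by rewrite inE closedN_id.
have sCU : C \subset U := subsetIr _ _.
have [|P [I [partP clP sI indI [domI cardI]]]] := IHm (U :\: C).
  rewrite -ltnS; apply: leq_trans leU; rewrite ltnS; apply: proper_card.
  by apply/properP; split; [apply: subsetDl | exists v; rewrite // inE vC].
have C_neq0 : C != set0 by apply/set0Pn; exists v.
have disC : [disjoint C & U :\: C].
  by apply/pred0P => z /=; rewrite in_setD; case: (z \in C).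
have notI z : z \in I -> z \notin C by move/(subsetP sI); rewrite in_setD => /andP[].
exists (C |: P), (v |: I); split.
- have -> : U = C :|: (U :\: C) by rewrite -{1}(setID U C) (setIidPr sCU).
  exact: partitionU1.
- by move=> B /setU1P[->//|/clP].
- rewrite subUset sub1set vU; apply: subset_trans sI _; exact: subsetDl.
- have not_adj z : z \in I -> ~~ adj v z.
    move=> zI; apply: contra (notI z zI) => vz; rewrite !inE vz orbT /=.
    by have := subsetP sI z zI; rewrite in_setD => /andP[].
  apply/forall_inP => y /setU1P[->|yI]; apply/forall_inP => z /setU1P[->|zI].
  + by rewrite adj_irr.
  + exact: not_adj.
  + by rewrite adj_sym not_adj.
  by have /forall_inP/(_ y yI)/forall_inP/(_ z zI) := indI.
split=> [u uU|].
  have [|uC] := boolP (u \in C).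
    by rewrite inE => /andP[uv _]; exists v; rewrite ?setU11.
  have [|w wI uw] := domI u; first by rewrite inE uC.
  by exists w; rewrite // setU1r.
(* Both cardinals grow by one: v is not in I, and C is not in P because P covers only U minus C. *)
rewrite !cardsU1 cardI; congr (_ + _); congr (nat_of_bool (~~ _)).
rewrite (contraTF (notI v)) ?vC //; apply/esym/negbTE; apply: contraTN vC => CP.
have : C \subset U :\: C by rewrite -(cover_partition partP); apply: (bigcup_max C).
by move/subsetP=> sC; apply/negP => vC; have := sC v vC; rewrite inE vC.
Qed.

(** T takes from each component of the complement of C one vertex adjacent to every vertex of C with
    a neighbour in that component. No edge joins two components, and each v in C has a neighbour
    outside C. *)
Lemma chordal_clique_avoided C :
    clique adj C -> (forall v, v \in C -> ~~ (closedN adj v \subset C)) ->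
  exists T, [/\ independent adj T, [disjoint T & C]
    & forall v, v \in C -> exists2 w, w \in T & adj v w].
Proof.
move=> clC notN; pose A := ~: C.
have disCA S : S \subset C -> [disjoint S & A].
  by move=> sSC; rewrite disjoint_sym disjoints_subset setCS.
pose dom (Q : {set 'I_n}) q :=
  (q \in Q) && [forall k in C, [exists y in Q, adj k y] ==> adj k q].
have domP a : a \in A -> exists q, dom (component A a) q.
  move=> aA; pose S := [set k in C | [exists y in component A a, adj k y]].
  have sSC : S \subset C by apply/subsetP => k; rewrite inE => /andP[].
  have clS : clique adj S.
    apply/cliqueP => y z /(subsetP sSC) yC /(subsetP sSC) zC.
    exact: (cliqueP _ _ clC).
  have [|q qa Sq] := chordal_component_dominates aA clS (disCA S sSC).
    by move=> k; rewrite inE => /andP[_ /exists_inP].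
  exists q; rewrite /dom qa; apply/forall_inP => k kC; apply/implyP => nbk.
  by apply: Sq; rewrite inE kC.
(* The root is a canonical name for a component, so that only one vertex per component is picked. *)
pose r := fingraph.root (induced A); have symA := induced_connect_sym A.
have rA a : a \in A -> r a \in A.
  by move=> aA; apply: (subsetP (component_sub aA)); rewrite inE connect_root.
pose f a := odflt a [pick q | dom (component A a) q].
have fP a : a \in A -> dom (component A a) (f a).
  by move=> aA; rewrite /f; case: pickP => //= no_q; have [q] := domP a aA; rewrite no_q.
have fA a : a \in A -> f a \in A.
  by move=> aA; have /andP[/(subsetP (component_sub aA))] := fP a aA.
exists [set f (r a) | a in A]; split.
- apply/forall_inP => _ /imsetP[a aA ->]; apply/forall_inP => _ /imsetP[b bA ->].
  apply/negP => adj_ab; have /andP[fa _] := fP _ (rA a aA).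
  have /andP[fb _] := fP _ (rA b bA).
  have := component_adj fa (fA _ (rA a aA)) (fA _ (rA b bA)) adj_ab.
  move: fb; rewrite !inE => rb ra; move: adj_ab; suff -> : r a = r b by rewrite adj_irr.
  rewrite -[r a](root_root symA) -[r b](root_root symA).
  by apply/eqP; rewrite (root_connect symA) (connect_trans ra) // symA.
- rewrite disjoints_subset; apply/subsetP => _ /imsetP[a aA ->].
  exact/fA/rA.
move=> v vC; have /subsetPn[y] := notN v vC; rewrite inE => vy yC.
have yA : y \in A by rewrite inE.
exists (f (r y)); first exact: imset_f.
have /andP[_ /forall_inP/(_ v vC)/implyP] := fP _ (rA y yA); apply.
apply/exists_inP; exists y; first by rewrite inE symA connect_root.
by case/predU1P: vy yC => [->|//]; rewrite vC.
Qed.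

Lemma well_covered_chordal_partition :
  well_covered adj -> exists P, free_clique_partition adj P.
Proof.
move=> wcG; have [P [I [partP clP _ indI [domI cardI]]]] := chordal_clique_cover setT.
have trivP := partition_trivIset partP.
have maxI : maxset (independent adj) I.
  apply/maxsetP; split=> // J /forall_inP indJ sIJ; apply/eqP.
  rewrite eqEsubset sIJ andbT; apply/subsetP => u uJ.
  have [|w wI] := domI u; first by rewrite inE.
  rewrite inE => /predU1P[->//|wu].
  by have /forall_inP/(_ u uJ) := indJ w (subsetP sIJ w wI); rewrite wu.
exists P; apply: free_clique_partition_intro => // C CP.
have clC := clP C CP; split=> //; apply/exists_inP; apply: contraT.
rewrite negb_exists_in => /forall_inP notN.
have [T [indT disTC domT]] := chordal_clique_avoided clC notN.
have [J maxJ sTJ] := maxset_exists indT.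
have /forall_inP indJ := maxsetp maxJ.
have JC u : u \in J -> u \notin C.
  move=> uJ; apply/negP => uC; have [w /(subsetP sTJ) wJ uw] := domT u uC.
  by have /forall_inP/(_ w wJ) := indJ u uJ; rewrite uw.
have inP_ u : u \in cover P by rewrite (cover_partition partP) inE.
(* J has at most one vertex in each block, as blocks are cliques, and none in C; so it is smaller
   than P, hence than I. *)
have : #|pblock P @: J| <= #|P :\ C|.
  apply/subset_leq_card/subsetP => _ /imsetP[u uJ ->]; rewrite in_setD1 pblock_mem // andbT.
  by apply: contraNneq (JC u uJ) => <-; rewrite mem_pblock.
rewrite card_in_imset => [|u w uJ wJ eq_uw]; last first.
  apply/eqP; apply: contraT => neq_uw.
  have := cliqueP _ _ (clP _ (pblock_mem (inP_ u))) u w.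
  rewrite mem_pblock inP_ eq_uw mem_pblock inP_ => /(_ isT isT neq_uw) uw.
  by have /forall_inP/(_ w wJ) := indJ u uJ; rewrite uw.
by rewrite -(wcG I J maxI maxJ) cardI [X in X <= _](cardsD1 C) CP ltnn.
Qed.

End Chordal.

(** * Whisker graphs *)

Section Whisker.
Variables (n : nat) (adj : rel 'I_n).
Hypothesis Gsimple : simple_graph adj.
Let adj_sym : ssrbool.symmetric adj := Gsimple.1.
Let adj_irr : irreflexive adj := Gsimple.2.

Lemma degree1P v :
  reflect (exists2 u, adj v u & forall w, adj v w -> w = u) (degree adj v == 1).
Proof.
apply: (iffP cards1P) => [[u /setP eqN]|[u vu only_u]]; exists u.
- by have := eqN u; rewrite !inE eqxx.
- by move=> w vw; have := eqN w; rewrite !inE vw => /esym/eqP.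
by apply/setP => w; rewrite !inE; apply/idP/eqP => [/only_u|->].
Qed.

Lemma whisker_partition :
  whisker_graph adj -> exists P, free_clique_partition adj P.
Proof.
move=> whG; pose P := [set closedN adj v | v : 'I_n & degree adj v == 1].
(* This serves disjointness: a vertex shared by two blocks may be adjacent to both leaves. *)
have leaf_eq u v w : degree adj v == 1 -> degree adj w == 1 ->
    adj u v -> adj u w -> v = w.
  move=> lv lw uv uw; case/orP: (whG u) => [/degree1P[z _ only_z]|].
    by rewrite (only_z v uv) (only_z w uw).
  case/cards1P=> z /setP eqz; have := eqz v; have := eqz w.
  by rewrite !inE uv uw lv lw => /esym/eqP-> /esym/eqP->.
exists P; apply: free_clique_partition_intro; last first.
  move=> _ /imsetP[v + ->]; rewrite inE => /degree1P[u vu only_u].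
  split; last by exists v; rewrite // closedN_id.
  apply/cliqueP => x y; rewrite !inE => /predU1P[->|/only_u->] /predU1P[->|/only_u->];
    by rewrite ?eqxx // adj_sym.
apply/and3P; split.
- rewrite eqEsubset subsetT; apply/subsetP => v _; apply/bigcupP.
  case/orP: (whG v) => [lv|]; first by exists (closedN adj v); rewrite ?closedN_id ?imset_f ?inE.
  case/cards1P=> w /setP/(_ w); rewrite !inE eqxx => /andP[vw lw].
  by exists (closedN adj w); rewrite ?imset_f ?inE // adj_sym vw orbT.
- apply/trivIsetP => _ _ /imsetP[v lv ->] /imsetP[w lw ->]; rewrite !inE in lv lw.
  apply: contraR => /pred0Pn[u /andP[]]; rewrite !inE.
  case/degree1P: (lv) => v' vv' only_v'; case/degree1P: (lw) => w' ww' only_w'.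
  (* Two adjacent leaves form an isolated edge and define the same block. *)
  have edge : adj v w -> closedN adj v = closedN adj w.
    move=> vw; apply/setP => z; rewrite !inE.
    have {}only_v' z0 : adj v z0 = (z0 == w).
      by apply/idP/eqP => [/only_v'->|-> //]; apply/esym/only_v'.
    have {}only_w' z0 : adj w z0 = (z0 == v).
      by apply/idP/eqP => [/only_w'->|-> //]; [apply/esym/only_w'; rewrite adj_sym | rewrite adj_sym].
    by rewrite only_v' only_w' orbC.
  case/predU1P=> [eq_uv|vu] /predU1P[eq_uw|wu].
  + by rewrite -eq_uv eq_uw.
  + by rewrite edge // adj_sym -eq_uv.
  + by rewrite edge // -eq_uw.
  by rewrite (leaf_eq u v w) // adj_sym.
by apply/imsetP => -[v _ /setP/(_ v)]; rewrite closedN_id inE.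
Qed.

End Whisker.

(** * The Hilbert function *)

Section Deltas.
Import GRing.Theory.
Local Open Scope ring_scope.
Variables (K : fieldType) (I : finType).
Implicit Types s : seq I.

Definition delta_ffun (b : I) : {ffun I -> K^o} := [ffun i => (b == i)%:R].

Lemma delta_ffun_free s : uniq s -> free [seq delta_ffun b | b <- s].
Proof.
elim: s => [|b s IHs] /=; first by rewrite nil_free.
case/andP=> bs Us; rewrite free_cons IHs // andbT; apply/negP => spanb.
have := coord_span (X := map_tuple delta_ffun (in_tuple s)) spanb.
move/ffunP/(_ b); rewrite sum_ffunE ffunE eqxx big1 => [/eqP|i _].
  by rewrite oner_eq0.
rewrite ffunE (nth_map b) ?size_tuple // ffunE.
have /negbTE-> : nth b s i != b; last exact: mulr0.
by apply: contraNneq bs => <-; rewrite mem_nth.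
Qed.

(** X may list a vector several times, as the generators of [NIk] do; only the distinct ones
    count. *)
Lemma dim_span_delta_ffun (X : seq {ffun I -> K^o}) (B : {set I}) :
    (forall f, f \in X <-> exists2 b, b \in B & f = delta_ffun b) ->
  \dim <<X>> = #|B|.
Proof.
move=> defX; have -> : <<X>>%VS = <<[seq delta_ffun b | b <- enum B]>>%VS.
  apply/eq_span => f; apply/idP/mapP => [/defX[b bB ->] | [b bB ->]].
    by exists b; rewrite ?mem_enum.
  by apply/defX; exists b; rewrite // -mem_enum.
by have /eqP-> := delta_ffun_free (enum_uniq B); rewrite size_map -cardE.
Qed.

End Deltas.

(** * Counting monomials by their missing variables *)

Section Monomials.
Variable n : nat.
Implicit Types (m : 'X_{1..n}) (A D : {set 'I_n}).

Definition zeros m : {set 'I_n} := [set i | m i == 0].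

(** This moves the monomials of each degree j up to k into one common finite type; the default [bm0]
    is never reached, since the degree bound only grows. *)
Lemma card_monomials_degree (Q : pred 'X_{1..n}) j k : j <= k ->
  #|[set m : 'X_{1..n < j.+1} | (mdeg m == j) && Q m]|
  = #|[set m : 'X_{1..n < k.+1} | (mdeg m == j) && Q m]|.
Proof.
move=> le_jk; pose f (m : 'X_{1..n < j.+1}) : 'X_{1..n < k.+1} := insubd bm0 (val m).
have fE (m : 'X_{1..n < j.+1}) : val (f m) = val m.
  by rewrite insubdK // unfold_in; apply: leq_trans (bmdeg m) _.
rewrite -(card_in_imset (f := f)) => [|m m' _ _ /(congr1 val)]; last first.
  by rewrite !fE => /val_inj.
apply: eq_card => m; apply/imsetP/idP => [[m' + ->]|]; rewrite !inE.
  by rewrite -!/(val _) fE.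
case/andP=> /eqP deg_m Qm; have lt_m : mdeg m < j.+1 by rewrite deg_m.
exists (BMultinom lt_m); first by rewrite inE /= deg_m eqxx.
by apply: val_inj; rewrite fE.
Qed.

(** Adding 1 to the entries of t makes the support exactly A, whatever t is. *)
Definition shift_mnm A (t : seq nat) : 'X_{1..n} :=
  [multinom (if i \in A then (nth 0 t (index i (enum A))).+1 else 0) | i < n].

Lemma index_enum_val A (j : 'I_#|A|) : index (enum_val j) (enum A) = j.
Proof.
rewrite (enum_val_nth (enum_val j)) index_uniq ?enum_uniq //.
by rewrite -cardE.
Qed.

Lemma shift_mnm_val A (t : #|A|.-tuple nat) (j : 'I_#|A|) :
  shift_mnm A t (enum_val j) = (tnth t j).+1.
Proof. by rewrite mnmE enum_valP index_enum_val (tnth_nth 0). Qed.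

Lemma mdeg_zeros m : mdeg m = \sum_(j < #|~: zeros m|) m (enum_val j).
Proof.
rewrite mdegE -(big_enum_val (fun i => m i)) (bigID (mem (~: zeros m))) /=.
by rewrite addnC big1 // => i; rewrite !inE negbK => /eqP.
Qed.

Lemma zeros_shift A t : zeros (shift_mnm A t) = ~: A.
Proof. by apply/setP => i; rewrite !inE mnmE; case: (i \in A). Qed.

Lemma mdeg_shift A (t : #|A|.-tuple nat) :
  mdeg (shift_mnm A t) = #|A| + \sum_(x <- t) x.
Proof.
rewrite mdeg_zeros zeros_shift setCK big_tuple.
under eq_bigr do rewrite shift_mnm_val -add1n.
by rewrite big_split /= sum1_card card_ord.
Qed.

(* Subtracting 1 from the nonzero exponents leaves #|~: D| naturals of sum at
   most k - #|~: D|. *)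
Lemma card_monomials_zeros D k :
  #|[set m : 'X_{1..n < k.+1} | zeros m == D]| = 'C(k, n - #|D|).
Proof.
have <- : #|~: D| = n - #|D| by rewrite cardsCs setCK card_ord.
(* For k below the size of A both sides vanish, since a monomial with support A has degree at least
   the size of A. *)
set A := ~: D; have [lt_kA|le_Ak] := ltnP k #|A|.
  rewrite bin_small //; apply/eqP; rewrite cards_eq0 -subset0; apply/subsetP => m.
  rewrite !inE => /eqP zm; have := bmdeg m; rewrite mdeg_zeros zm -/A ltnS leqNgt => /negP[].
  apply: leq_trans lt_kA _; apply: (@leq_trans (\sum_(j < #|A|) 1)).
    by rewrite sum1_card card_ord.
  apply: leq_sum => j _; rewrite lt0n.
  by have := enum_valP j; rewrite [in X in _ \in X -> _]/A -zm !inE.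
pose b := k - #|A|.
(* Entries bounded by b suffice, since no entry of a tuple of naturals of sum at most b exceeds
   b. *)
have -> : 'C(k, #|A|) = #|[set t : #|A|.-tuple 'I_b.+1 | \sum_(x <- t) x <= b]|.
  by rewrite card_partial_ord_partitions subnKC.
pose vt (t : #|A|.-tuple 'I_b.+1) := map_tuple val t.
pose f (t : #|A|.-tuple 'I_b.+1) : 'X_{1..n < k.+1} := insubd bm0 (shift_mnm A (vt t)).
have fE (t : #|A|.-tuple 'I_b.+1) : \sum_(x <- t) x <= b -> val (f t) = shift_mnm A (vt t).
  move=> sum_t; rewrite insubdK // unfold_in mdeg_shift big_map ltnS.
  by rewrite -(subnKC le_Ak) leq_add2l.
rewrite -(card_in_imset (f := f)) => [|t t'].
  apply: eq_card => m; apply/idP/imsetP => [|[t]]; rewrite !inE; last first.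
    by move=> sum_t ->; rewrite -!/(val _) fE // zeros_shift setCK.
  move=> /eqP zm; have := bmdeg m; rewrite ltnS => deg_m.
  have m_gt0 (j : 'I_#|A|) : 0 < m (enum_val j).
    by have := enum_valP j; rewrite [in X in _ \in X -> _]/A -zm !inE lt0n.
  have sum_m : \sum_(j < #|A|) (m (enum_val j)).-1 <= b.
    rewrite -(leq_add2l #|A|) subnKC //; apply: leq_trans deg_m.
    apply: (@leq_trans (\sum_(j < #|A|) 1 + \sum_(j < #|A|) (m (enum_val j)).-1)).
      by rewrite sum1_card card_ord.
    rewrite mdeg_zeros zm -/A -big_split /=.
    by apply: leq_sum => j _; rewrite add1n prednK.
  (* The preimage of m; [inord] truncates nothing, because [sum_m] bounds every entry by b. *)
  pose t := [tuple (inord (m (enum_val j)).-1 : 'I_b.+1) | j < #|A|].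
  have tE j : tnth t j = (m (enum_val j)).-1 :> nat.
    rewrite tnth_mktuple inordK // ltnS; apply: leq_trans sum_m.
    by rewrite (bigD1 j) //= leq_addr.
  have sum_t : \sum_(x <- t) x <= b.
    by rewrite big_tuple (eq_bigr _ (fun j _ => tE j)).
  exists t; first by rewrite inE.
  apply: val_inj; rewrite fE //; apply/mnmP => i.
  have [iA|iA] := boolP (i \in A).
    rewrite -(enum_rankK_in iA iA) shift_mnm_val tnth_map.
    by rewrite [RHS](congr1 succn (tE _)) prednK.
  by rewrite mnmE (negbTE iA); move: iA; rewrite inE negbK -zm inE => /eqP.
rewrite !inE => sum_t sum_t' /(congr1 val); rewrite !fE // => eq_f.
apply: eq_from_tnth => j; apply: val_inj.
have := congr1 (fun m : 'X_{1..n} => m (enum_val j)) eq_f.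
by rewrite /= !shift_mnm_val !tnth_map => -[].
Qed.

End Monomials.

(** * The Hilbert function of the quotient by NI(G) *)

Section HilbertFunction.
Import GRing.Theory.
Variables (K : fieldType) (n : nat) (adj : rel 'I_n).
Local Open Scope mpoly_scope.

Lemma hcompX k (m : 'X_{1..n < k.+1}) :
  mdeg m == k -> hcomp k ('X_[m] : {mpoly K[n]}) = delta_ffun K m.
Proof.
move=> deg_m; apply/ffunP => m'; rewrite !ffunE mcoeffX val_eqE.
by have [<-|_] := eqVneq m m'; rewrite ?deg_m ?if_same.
Qed.

Lemma dim_Sk k :
  \dim (Sk K n k) = #|[set m : 'X_{1..n < k.+1} | mdeg m == k]|.
Proof.
apply: dim_span_delta_ffun => f; split=> [/mapP[m]|[m]].
  by rewrite mem_filter => /andP[deg_m _] ->; exists m; rewrite ?inE ?hcompX.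
rewrite inE => deg_m ->; apply/mapP; exists m; last by rewrite hcompX.
by rewrite mem_filter deg_m mem_enum inE.
Qed.

Definition closedN_mnm v : 'X_{1..n} := [multinom (w \in closedN adj v : nat) | w < n].

Lemma NIgenE v : NIgen K adj v = 'X_[closedN_mnm v].
Proof.
rewrite /NIgen mprodXE; congr mpolyX; apply/mnmP => w; rewrite mnm_sumE mnmE.
case vw: (w \in closedN adj v).
  rewrite (bigD1 w) //= mnm1E eqxx big1 // => u /andP[_ /negbTE neq_uw].
  by rewrite mnm1E neq_uw.
by rewrite big1 // => u uv; rewrite mnm1E; case: eqP vw => // <-; rewrite uv.
Qed.

Lemma mdeg_closedN v : mdeg (closedN_mnm v) = #|closedN adj v|.
Proof.
rewrite mdegE -sum1_card [RHS]big_mkcond; apply: eq_bigr => w _; rewrite mnmE.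
by case: (w \in _).
Qed.

(** The generator at v divides m exactly when N[v] contains no variable missing from m, that is,
    when [zeros m] fails to dominate v. *)
Lemma dominating_zeros (m : 'X_{1..n}) :
  ~~ dominating adj (zeros m) = [exists v, (closedN_mnm v <= m)%MM].
Proof.
rewrite negb_forall; apply: eq_existsb => v; rewrite negb_exists_in.
apply/forall_inP/mnm_lepP => [no_w w|le_vm w].
  rewrite mnmE; case vw: (w \in _) => //=; rewrite lt0n.
  by apply: contraL vw => m0; apply: no_w; rewrite inE.
rewrite inE => /eqP m0; have := le_vm w; rewrite mnmE m0; by case: (w \in _).
Qed.

Lemma dim_NIk k :
  \dim (NIk K adj k)
  = #|[set m : 'X_{1..n < k.+1} | (mdeg m == k) && ~~ dominating adj (zeros m)]|.
Proof.
apply: dim_span_delta_ffun => f; split=> [/mapP[[m v]]|[m]].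
  rewrite mem_filter /= => /andP[deg_mv _] ->.
  have deg_sum : mdeg (m + closedN_mnm v)%MM == k by rewrite mdegD mdeg_closedN.
  have lt_sum : mdeg (m + closedN_mnm v)%MM < k.+1 by rewrite ltnS (eqP deg_sum).
  exists (BMultinom lt_sum); last first.
    by rewrite NIgenE -mpolyXD -(@hcompX _ (BMultinom lt_sum)).
  rewrite inE deg_sum dominating_zeros; apply/existsP; exists v; exact: lem_addl.
rewrite inE dominating_zeros => /andP[deg_m /existsP[v le_vm]] ->; apply/mapP.
have lt_B : mdeg (m - closedN_mnm v)%MM < k.+1.
  by apply: leq_ltn_trans (mdegB _ _) (bmdeg m).
exists (BMultinom lt_B, v) => /=; last by rewrite NIgenE -mpolyXD submK // hcompX.
by rewrite mem_filter mem_enum inE andbT /= -mdeg_closedN -mdegD submK.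
Qed.

Lemma hilbNIE k : hilbNI K adj k =
  #|[set m : 'X_{1..n < k.+1} | (mdeg m == k) && dominating adj (zeros m)]|.
Proof.
rewrite /hilbNI dim_Sk dim_NIk; set A := [set m | _]; set B := [set m | _].
rewrite -(setIidPr (_ : B \subset A)); last first.
  by apply/subsetP => m; rewrite !inE => /andP[].
rewrite -cardsDS ?subsetIl // setDIr setDv set0U.
by apply: eq_card => m; rewrite !inE; case: (mdeg m == k); rewrite /= ?andbT ?negbK.
Qed.

(** The monomials of degree at most k with dominating zero set are counted twice, by degree and by
    zero set. *)
Lemma sum_hilbNI k :
  \sum_(j < k.+1) hilbNI K adj j
  = \sum_(D : {set 'I_n} | dominating adj D) 'C(k, n - #|D|).
Proof.
pose Z := [set m : 'X_{1..n < k.+1} | dominating adj (zeros m)].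
transitivity #|Z|.
  rewrite -sum1_card (partition_big (fun m => Ordinal (bmdeg m)) predT) //=.
  apply: eq_bigr => j _; rewrite hilbNIE.
  have le_jk : j <= k by rewrite -ltnS.
  apply: etrans (card_monomials_degree (fun m => dominating adj (zeros m)) le_jk) _.
  by rewrite sum1_card; apply: eq_card => m; rewrite !inE [RHS]unfold_in inE andbC.
rewrite -sum1_card.
rewrite (partition_big (fun m : 'X_{1..n < k.+1} => zeros m) (dominating adj)) /=; last first.
  by move=> m; rewrite inE.
apply: eq_bigr => D domD; rewrite -card_monomials_zeros sum1_card.
apply: eq_card => m; rewrite !inE [LHS]unfold_in inE.
by apply: andb_idl => /eqP->.
Qed.

End HilbertFunction.

(** * Binomial coefficients as polynomials *)

Section BinomialPolynomial.
Import GRing.Theory Num.Theory.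
Local Open Scope ring_scope.

Definition binomial_poly s : {poly rat} :=
  (s`!%:R)^-1 *: \prod_(i < s) ('X - i%:R%:P).

Lemma horner_binomial_poly s k : (binomial_poly s).[k%:R] = ('C(k, s))%:R.
Proof.
have fact_neq0 : s`!%:R != 0 :> rat by rewrite pnatr_eq0 -lt0n fact_gt0.
rewrite hornerZ; apply: (mulfI fact_neq0); rewrite mulVKf //.
rewrite -natrM mulnC bin_ffact horner_prod ffact_prod natr_prod.
(* For k < s both products vanish through the factor i = k; otherwise the natural subtraction is
   never truncated. *)
have [lt_ks|le_sk] := ltnP k s.
  rewrite (bigD1 (Ordinal lt_ks)) //= hornerXsubC subrr mul0r.
  by rewrite (bigD1 (Ordinal lt_ks)) //= subnn mul0r.
apply: eq_bigr => i _; rewrite hornerXsubC natrB //.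
by apply: leq_trans le_sk; apply: ltnW.
Qed.

Lemma size_binomial_poly s : size (binomial_poly s) = s.+1.
Proof.
rewrite size_scale ?invr_eq0 ?pnatr_eq0 -?lt0n ?fact_gt0 //.
rewrite -(big_mkord xpredT (fun i => 'X - i%:R%:P)) size_prod_XsubC.
by rewrite size_iota subn0.
Qed.

Lemma lead_coef_binomial_poly s : (binomial_poly s)`_s = (s`!%:R)^-1.
Proof.
have := lead_coefZ (s`!%:R^-1 : rat) (\prod_(i < s) ('X - i%:R%:P)).
rewrite (monicP (monic_prod_XsubC _ _ _)) mulr1 => <-.
by rewrite lead_coefE -/(binomial_poly s) size_binomial_poly.
Qed.

End BinomialPolynomial.

(** * The multiplicity from the leading coefficient *)

Section Multiplicity.
Import GRing.Theory Num.Theory.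
Local Open Scope ring_scope.
Variables (K : fieldType) (n : nat) (adj : rel 'I_n).

Lemma multiplicity_NI : is_multiplicity (hilbNI K adj) (nmin_gamma adj).
Proof.
(* The largest degree among the summands, reached exactly at the dominating sets of size [gamma]. *)
pose d := (n - gamma adj)%N.
pose P := \sum_(D : {set 'I_n} | dominating adj D) binomial_poly (n - #|D|).
have size_P : (size P <= d.+1)%N.
  apply: (leq_trans (size_sum _ _ _)); apply/bigmax_leqP => D domD.
  by rewrite size_binomial_poly ltnS leq_sub2l ?gamma_le.
have P_d : P`_d = (nmin_gamma adj)%:R / d`!%:R.
  rewrite coef_sum (bigID (fun D : {set 'I_n} => #|D| == gamma adj)) /=.
  rewrite [X in _ + X]big1 ?addr0 => [|D /andP[domD neq_D]]; last first.
    rewrite nth_default // size_binomial_poly /d ltn_sub2lE.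
      by rewrite ltn_neqAle eq_sym neq_D gamma_le.
    by rewrite -[X in (_ <= X)%N](card_ord n) max_card.
  rewrite (eq_bigr (fun=> (d`!%:R)^-1)) => [|D /andP[_ /eqP->]]; last first.
    exact: lead_coef_binomial_poly.
  rewrite sumr_const nmin_gammaE -[LHS]mulr_natl; congr (_%:R * _).
  by apply: eq_card => D; rewrite !inE.
(* A minimum dominating set exists, so the terms of degree d do not cancel and P has degree exactly
   d. *)
have P_d_neq0 : P`_d != 0.
  rewrite P_d mulf_neq0 ?invr_eq0 ?pnatr_eq0 -?lt0n ?fact_gt0 //.
  exact: nmin_gamma_gt0.
have size_PE : size P = d.+1.
  apply/eqP; rewrite eqn_leq size_P ltnNge; apply: contra P_d_neq0 => le_Pd.
  by rewrite nth_default.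
exists d, P; split=> //; first by rewrite lead_coefE size_PE.
exists 0%N => k _; rewrite sum_hilbNI horner_sum natr_sum.
by apply: eq_bigr => D _; rewrite horner_binomial_poly.
Qed.

End Multiplicity.

Theorem theorem3p11 (K : fieldType) (n : nat) (adj : rel 'I_n) :
  (0 < n)%N -> simple_graph adj ->
  (* (a) *)
  [/\ is_multiplicity (hilbNI K adj) (nmin_gamma adj),
      (nmin_gamma adj <= dnum adj)%N &
      (nmin_gamma adj = dnum adj <-> well_dominated adj)] /\
  (* (b) *)
  (forall P : {set {set 'I_n}}, free_clique_partition adj P ->
     is_multiplicity (hilbNI K adj) (dnum adj) /\
     dnum adj = (\prod_(C in P) #|C|)%N) /\
  (* in particular for well-covered chordal graphs and whisker graphs *)
  ((well_covered adj /\ chordal adj) \/ whisker_graph adj ->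
     exists P : {set {set 'I_n}}, free_clique_partition adj P /\
       is_multiplicity (hilbNI K adj) (dnum adj) /\
       dnum adj = (\prod_(C in P) #|C|)%N).
Proof.
move=> _ Gsimple; have mult := multiplicity_NI K adj.
have partG P : free_clique_partition adj P ->
    is_multiplicity (hilbNI K adj) (dnum adj) /\
    dnum adj = (\prod_(C in P) #|C|)%N.
  move=> freeP; split.
    (* All transversals have the same size, so the count in (a) is the number of all minimal
       dominating sets. *)
    have /nmin_gamma_eq_dnum <- // := free_clique_partition_well_dominated Gsimple freeP.
  rewrite -(card_transversals freeP.1); apply: eq_card => D.
  by rewrite !inE (minimal_dominating_partition Gsimple freeP).
split; first by split=> //; [apply: nmin_gamma_le_dnum | apply: nmin_gamma_eq_dnum].
split=> // -[[wcG chG] | whG].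
  have [P freeP] := well_covered_chordal_partition Gsimple chG wcG.
  by exists P; split=> //; apply: partG.
have [P freeP] := whisker_partition Gsimple whG.
by exists P; split=> //; apply: partG.
Qed.
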